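(* Let $n\ge3$, $\alpha,\alpha'\in\Bbbk^n$ and $\beta,\beta'\in(\Bbbk^\times)^n$. Then $\mathcal H(\alpha,\beta,0)\cong\mathcal H(\alpha',\beta',0)$ if and only if there exist $\lambda\in(\Bbbk^\times)^n$ and $k\in Q_0$ such that one of the following holds for all $i\in Q_0$ (indices mod $n$): (1) $\alpha'_i=\lambda_{i+k}\lambda_{i+k-1}^{-1}\alpha_{i+k}$ and $\beta'_i=\lambda_{i+k+1}\lambda_{i+k-1}^{-1}\beta_{i+k}$; or (2) $\alpha'_i=-\lambda_{n-i-k}^{-1}\lambda_{n-i-k-1}\beta_{n-i-k-1}^{-1}\alpha_{n-i-k-1}$ and $\beta'_i=\lambda_{n-i-k}^{-1}\lambda_{n-i-k-2}\beta_{n-i-k-1}^{-1}$.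
   Context: $\Bbbk$ is an algebraically closed field of characteristic zero. Indices mod $n$, $Q_0=\{0,\dots,n-1\}$. $Q$ is the quiver with vertices $Q_0$ and arrows $u_i:i\to i+1$, $d_i:i+1\to i$; paths are written left to right, $e_i$ is the trivial path at $i$. For $\alpha,\beta\in\Bbbk^n$, $\mathcal H(\alpha,\beta,0)$ is $\Bbbk Q$ modulo the relations $d_{i-1}u_{i-1}u_i=\alpha_iu_id_iu_i+\beta_iu_iu_{i+1}d_{i+1}$ and $d_id_{i-1}u_{i-1}=\alpha_id_iu_id_i+\beta_iu_{i+1}d_{i+1}d_i$ for all $i\in Q_0$. Isomorphism means isomorphism of $\Bbbk$-algebras. *)

(* Defs.v *)
From HB Require Import structures.
From mathcomp Require Import all_boot all_order all_algebra.
From mathcomp Require Import monalg.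
Set Implicit Arguments. Unset Strict Implicit. Unset Printing Implicit Defensive.
Import GRing.Theory.
Local Open Scope ring_scope.

(* Generators of the free algebra: (0,i) = e_i, (1,i) = u_i, (2,i) = d_i. *)
Definition letter (n : nat) : Type := ('I_3 * 'I_n)%type.

Definition FreeAlg (K : fieldType) (n : nat) := {malg K[{fmonom (letter n)}]}.

Definition gen (K : fieldType) (n : nat) (c : 'I_3) (m : nat) : FreeAlg K n :=
  if insub (m %% n)%N is Some j then << fmu ((c, j) : letter n) >> else 0.

Definition ee K n m := @gen K n (@Ordinal 3 0 isT) m.
Definition uu K n m := @gen K n (@Ordinal 3 1 isT) m.
Definition dd K n m := @gen K n (@Ordinal 3 2 isT) m.

Definition cyc (K : fieldType) (n : nat) (f : 'I_n -> K) (m : nat) : K :=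
  if insub (m %% n)%N is Some j then f j else 0.

(* Defining relations of H(alpha, beta, 0), as elements of the free algebra:
   first those presenting the path algebra kQ (e_i orthogonal idempotents
   summing to 1, and a = e_{s(a)} a e_{t(a)} for every arrow, paths written
   left to right), then the two families of relations of the paper. *)
Definition relH (K : fieldType) (n : nat) (al be : 'I_n -> K)
    (r : FreeAlg K n) : Prop :=
  let e := @ee K n in let u := @uu K n in let d := @dd K n in
  let a := cyc al in let b := cyc be in
  ((exists i j : 'I_n, r = e i * e j - (if i == j then e i else 0)) \/
   r = \sum_(i < n) e i - 1 \/
   (exists i : 'I_n, r = e i * u i - u i) \/
   (exists i : 'I_n, r = u i * e (i.+1)%N - u i) \/
   (exists i : 'I_n, r = e (i.+1)%N * d i - d i) \/
   (exists i : 'I_n, r = d i * e i - d i)) \/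
  (exists i : 'I_n, r = d ((i + n).-1)%N * u ((i + n).-1)%N * u i
      - (a i *: (u i * d i * u i) + b i *: (u i * u (i.+1)%N * d (i.+1)%N))) \/
  (exists i : 'I_n, r = d i * d ((i + n).-1)%N * u ((i + n).-1)%N
      - (a i *: (d i * u i * d i) + b i *: (u (i.+1)%N * d (i.+1)%N * d i))).

Definition in_ideal (K : fieldType) (n : nat) (R : FreeAlg K n -> Prop)
    (x : FreeAlg K n) : Prop :=
  exists s : seq (FreeAlg K n * FreeAlg K n * FreeAlg K n),
    (forall t, t \in s -> R t.1.2) /\
    x = \sum_(t <- s) t.1.1 * t.1.2 * t.2.

Definition congH (K : fieldType) (n : nat) (al be : 'I_n -> K)
    (x y : FreeAlg K n) : Prop :=
  in_ideal (relH al be) (x - y).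

(* H(alpha,beta,0) = FreeAlg / I and H(alpha',beta',0) = FreeAlg / I' are
   isomorphic as K-algebras: there is a map of representatives f inducing a
   well-defined, K-linear, multiplicative, unital, bijective map of the
   quotients. *)
Definition H_iso (K : fieldType) (n : nat) (al be al' be' : 'I_n -> K) : Prop :=
  exists f : FreeAlg K n -> FreeAlg K n,
    let c := congH al be in let c' := congH al' be' in
    (forall x y, c x y -> c' (f x) (f y)) /\
    (forall x y, c' (f (x + y)) (f x + f y)) /\
    (forall (k : K) x, c' (f (k *: x)) (k *: f x)) /\
    (forall x y, c' (f (x * y)) (f x * f y)) /\
    c' (f 1) 1 /\
    (forall x y, c' (f x) (f y) -> c x y) /\
    (forall y, exists x, c' (f x) y).

(* Main.v *)
Require Import Defs.
From HB Require Import structures.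
From mathcomp Require Import all_boot all_order all_algebra.
From mathcomp Require Import finmap monalg zify ring.
Import GRing.Theory.
Local Open Scope ring_scope.
Set Implicit Arguments. Unset Strict Implicit. Unset Printing Implicit Defensive.

(** Trivial paths and arrows of H = H(alpha, beta, 0) live on a cycle without
loops, so every character of H sends one e_i to 1 and all other generators to 0;
an isomorphism H -> H' therefore induces a bijection tau of the vertices.
The coefficient of an arrow i -> j in H' is a derivation from chi_i to chi_j;
its pullback to H is not inner, hence is nonzero on an arrow tau(i) -> tau(j).
So tau preserves adjacency, and since n >= 3 it is a rotation or a reflection of
the cycle. To leading order the isomorphism thus rescales each arrow of H to the
corresponding arrow of H', and comparing the coefficients of paths of length 3
on both sides of one cubic relation at each vertex gives (1) for a rotation and
(2) for a reflection, where lambda_i is built from the product of the two scalars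
of the pair u_i, d_i. Conversely (1) and (2) are exactly the conditions under
which relabelling the vertices and rescaling the d_i carries relators to multiples
of relators. *)

(** * The free algebra: monomials, ideals, and endomorphisms that relabel and rescale letters *)

HB.lock Definition mon (K : fieldType) (n : nat) (w : seq (letter n)) : FreeAlg K n :=
  << FMonom w >>.

(* The algebra endomorphism that sends the letter l to s l times the letter th l. *)
HB.lock Definition monomial_endo (K : fieldType) (n : nat) (th : letter n -> letter n)
    (s : letter n -> K) (x : FreeAlg K n) : FreeAlg K n :=
  \sum_(w <- msupp x) (x@_w * \prod_(l <- w : seq _) s l) *: mon K (map th w).

Section FreeAlgebra.
Variables (K : fieldType) (n : nat).
Local Notation A := (FreeAlg K n).
Local Notation mon := (@mon K n).


Lemma monM v w : mon v * mon w = mon (v ++ w).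
Proof.
rewrite mon.unlock; apply/malgP=> k; rewrite mcoeffMl !msuppU1 !big_seq_fset1 /= !mcoeffUU mulr1.
by rewrite mcoeffU; congr (_ *+ (_ == k)); apply: val_inj; rewrite /= fmM.
Qed.

Lemma mon0 : mon [::] = 1.
Proof. by rewrite mon.unlock; congr mkmalgU; apply: val_inj; rewrite /= fm1. Qed.

Lemma FreeAlg_scaleAr (c : K) (x y : A) : c *: (x * y) = x * (c *: y).
Proof.
move: x y; rewrite /FreeAlg => x y; apply/malgP=> k; rewrite mcoeffZ.
rewrite (mcoeffMlw _ (fsubset_refl (msupp x)) (msuppZ_le c y)) mcoeffMl.
rewrite mulr_sumr; apply: eq_bigr => v _; rewrite mulr_sumr.
by apply: eq_bigr => w _; rewrite mcoeffZ mulrnAr mulrCA.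
Qed.

Lemma FreeAlg_mon_ind (P : A -> Prop) :
  P 0 -> (forall c x y, P x -> P y -> P (c *: x + y)) ->
  (forall w, P (mon w)) -> forall x, P x.
Proof.
move=> P0 PD Pm x; rewrite (monalgE x); elim/big_rec: _ => // w y _ Py.
suff -> : << x@_w *g w >> = x@_w *: mon w by apply: PD.
by rewrite mon.unlock; apply/malgP=> k; rewrite mcoeffZ !mcoeffU fmK mulr_natr.
Qed.

Lemma FreeAlg_letter_ind (P : A -> Prop) :
  P 0 -> (forall c x y, P x -> P y -> P (c *: x + y)) -> P 1 ->
  (forall l x, P x -> P (mon [:: l] * x)) -> forall x, P x.
Proof.
move=> P0 PD P1 PM; apply: FreeAlg_mon_ind => //; elim=> [|l w IH].
  by rewrite mon0.
by rewrite -cat1s -monM; apply: PM.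
Qed.

Lemma in_ideal_rel (R : A -> Prop) r : R r -> in_ideal R r.
Proof.
move=> Rr; exists [:: (1, r, 1)]; rewrite big_seq1 /= mul1r mulr1.
by split=> // t; rewrite inE => /eqP->.
Qed.

Lemma in_ideal0 (R : A -> Prop) : in_ideal R 0.
Proof. by exists [::]; rewrite big_nil. Qed.

Lemma in_idealD (R : A -> Prop) x y :
  in_ideal R x -> in_ideal R y -> in_ideal R (x + y).
Proof.
move=> [s [sR ->]] [t [tR ->]]; exists (s ++ t); rewrite big_cat; split=> // u.
by rewrite mem_cat => /orP[/sR|/tR].
Qed.

Lemma in_ideal_mono (R R' : A -> Prop) x :
  (forall r, R r -> R' r) -> in_ideal R x -> in_ideal R' x.
Proof. by move=> RR' [s [sR ->]]; exists s; split=> // t /sR/RR'. Qed.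

Lemma in_idealZM (R : A -> Prop) c a r b : R r -> in_ideal R (a * (c *: r) * b).
Proof.
move=> Rr; exists [:: (c *: a, r, b)]; rewrite big_seq1 /=; split=> [t|].
  by rewrite inE => /eqP->.
by rewrite -FreeAlg_scaleAr scalerAl.
Qed.

Section MonomialEndo.
Variables (th : letter n -> letter n) (s : letter n -> K).
Local Notation F := (monomial_endo th s).

(** Any finite set containing the support may index the sum, so the supports of several elements can
    be replaced by one common set. *)
Lemma monomial_endoEw (d : {fset _}) x : (msupp x `<=` d)%fset ->
  F x = \sum_(w <- d) (x@_w * \prod_(l <- w : seq _) s l) *: mon (map th w).
Proof.
rewrite monomial_endo.unlock => le; rewrite [LHS](big_fset_incl _ le) => //= w wd /mcoeff_outdom ->.
by rewrite mul0r scale0r.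
Qed.

Lemma monomial_endo_linear c x y : F (c *: x + y) = c *: F x + F y.
Proof.
pose d := (msupp (c *: x + y) `|` (msupp x `|` msupp y))%fset.
rewrite !(@monomial_endoEw d) ?fsubsetUl //; last 2 first.
- by rewrite fsubsetU // fsubsetUr orbT.
- by rewrite fsubsetU // fsubsetUl orbT.
rewrite scaler_sumr -big_split; apply: eq_bigr => w _ /=.
by rewrite mcoeffD mcoeffZ mulrDl scalerDl scalerA mulrA.
Qed.

Lemma monomial_endo0 : F 0 = 0.
Proof. by rewrite monomial_endo.unlock msupp0 big_seq_fset0. Qed.

Lemma monomial_endoD x y : F (x + y) = F x + F y.
Proof. by rewrite -[x]scale1r monomial_endo_linear !scale1r. Qed.

Lemma monomial_endoZ c x : F (c *: x) = c *: F x.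
Proof. by rewrite -[c *: x]addr0 monomial_endo_linear monomial_endo0 addr0. Qed.

Lemma monomial_endoB x y : F (x - y) = F x - F y.
Proof. by rewrite -scaleN1r monomial_endoD monomial_endoZ scaleN1r. Qed.

Lemma monomial_endo_sum (I : Type) (r : seq I) G :
  F (\sum_(i <- r) G i) = \sum_(i <- r) F (G i).
Proof. by apply: (big_morph F monomial_endoD monomial_endo0). Qed.

Lemma monomial_endo_mon w : F (mon w) = (\prod_(l <- w) s l) *: mon (map th w).
Proof. by rewrite monomial_endo.unlock mon.unlock msuppU1 big_seq_fset1 mcoeffUU mul1r. Qed.

Lemma monomial_endo1 : F 1 = 1.
Proof. by rewrite -mon0 monomial_endo_mon big_nil scale1r. Qed.

Lemma monomial_endoM x y : F (x * y) = F x * F y.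
Proof.
elim/FreeAlg_mon_ind: x => [|c x x' Hx Hx'|v].
- by rewrite monomial_endo0 !mul0r monomial_endo0.
- by rewrite mulrDl -scalerAl !monomial_endo_linear Hx Hx' mulrDl scalerAl.
elim/FreeAlg_mon_ind: y => [|c y y' Hy Hy'|w].
- by rewrite monomial_endo0 !mulr0 monomial_endo0.
- rewrite mulrDr -FreeAlg_scaleAr !monomial_endo_linear Hy Hy' mulrDr.
  by rewrite FreeAlg_scaleAr.
rewrite monM !monomial_endo_mon big_cat /= map_cat -monM.
by rewrite -scalerAl -FreeAlg_scaleAr scalerA.
Qed.

End MonomialEndo.

Lemma monomial_endoK th s th' s' : cancel th th' -> (forall l, s l * s' (th l) = 1) ->
  cancel (@monomial_endo K n th s) (@monomial_endo K n th' s').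
Proof.
move=> thK sK; elim/FreeAlg_mon_ind => [|c x y Hx Hy|w].
- by rewrite !monomial_endo0.
- by rewrite !monomial_endo_linear Hx Hy.
rewrite monomial_endo_mon monomial_endoZ monomial_endo_mon scalerA.
rewrite mapK // big_map -big_split big1 ?scale1r //= => l _; exact: sK.
Qed.

(** By multiplicativity it is enough to control relators, and only up to scalars, which the outer
    factors absorb. *)
Lemma monomial_endo_ideal (th : letter n -> letter n) (s : letter n -> K) (R R' : A -> Prop) x :
  (forall r, R r -> exists c r', R' r' /\ monomial_endo th s r = c *: r') ->
  in_ideal R x -> in_ideal R' (monomial_endo th s x).
Proof.
move=> RR' [t [tR ->]]; rewrite monomial_endo_sum big_seq.
apply: (big_ind (in_ideal R')) => [||u /tR/RR' [c [r' [Rr' Fr]]]].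
- exact: in_ideal0.
- exact: in_idealD.
by rewrite !monomial_endoM Fr; apply: in_idealZM.
Qed.

End FreeAlgebra.

(** * The cyclic quiver, with vertices in the ring Z/n, and its paths *)

Section CyclicQuiver.
Variable N : nat.
Local Notation n := N.+3.
Local Notation vertex := 'I_n.

(* Directions: [true] is the arrow u_i out of i, [false] the arrow d_(i-1) out of i. *)
Definition step (s : bool) (i : vertex) : vertex := if s then i + 1 else i - 1.

Definition idem_letter (i : vertex) : letter n := (ord0, i).
(** Naming arrows by direction and source treats u and d uniformly. The index [i - 1] appears
    because d_j starts at j + 1. *)
Definition arrow_letter (s : bool) (i : vertex) : letter n :=
  if s then (@Ordinal 3 1 isT, i) else (@Ordinal 3 2 isT, i - 1).

Fixpoint path_letters (p : seq bool) (i : vertex) : seq (letter n) :=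
  if p is s :: q then arrow_letter s i :: path_letters q (step s i) else [::].

Fixpoint target (p : seq bool) (i : vertex) : vertex :=
  if p is s :: q then target q (step s i) else i.

Lemma inZp_nat (m : nat) : inZp m = m%:R :> vertex.
Proof. exact: esym (@Zp_nat N.+1 m). Qed.

Lemma vertex_natK (i : vertex) : (i : nat)%:R = i.
Proof. exact: (@natr_Zp N.+1 i). Qed.

Lemma natr_order : n%:R = 0 :> vertex.
Proof. by apply: val_inj; rewrite -inZp_nat /= modnn. Qed.

Lemma stepK s : cancel (step s) (step (~~ s)).
Proof. by case: s => i; rewrite /= /step ?addrK ?subrK. Qed.

Lemma step_up_down (i : vertex) : step true (step false i) = i.
Proof. exact: stepK false i. Qed.

Lemma step_down_up (i : vertex) : step false (step true i) = i.
Proof. exact: stepK true i. Qed.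

Lemma step_neq s (i : vertex) : step s i != i.
Proof.
case: s; rewrite /step -subr_eq0 addrAC subrr add0r ?oppr_eq0;
by rewrite -val_eqE.
Qed.

Lemma step_inj_dir (i : vertex) : injective (step^~ i).
Proof.
(* Here n >= 3 matters: 1 and -1 are distinct modulo n, so the two neighbours of a vertex differ. *)
have two_neq0 : (1 + 1 : vertex) != 0 by rewrite -val_eqE.
by do 2!case=> //; move/addrI/eqP; rewrite ?[- 1 == 1]eq_sym -addr_eq0 (negPf two_neq0).
Qed.

Lemma vertex_ind (P : vertex -> Prop) :
  P 0 -> (forall i, P i -> P (step true i)) -> forall i, P i.
Proof.
move=> P0 PS i; rewrite -(vertex_natK i); elim: (i : nat) => // m.
by rewrite mulrSr; exact: PS.
Qed.

(** * Adjacency-preserving injections of the cycle are rotations or reflections *)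

Section Dihedral.
Variables (tau : vertex -> vertex) (o : vertex -> bool -> bool).
Hypotheses (tau_inj : injective tau)
  (tau_step : forall i s, tau (step s i) = step (o i s) (tau i)).

(** Injectivity sends the two neighbours of a vertex to opposite sides, and adjacent vertices share
    an edge, so the orientation propagates around the cycle. *)
Lemma orientation_constant : exists e, forall i s, o i s = (s == e).
Proof.
have oN i : o i false = ~~ o i true.
  have : o i false != o i true.
    by apply/eqP=> oE; have := tau_step i false; rewrite oE -tau_step => /tau_inj/step_inj_dir.
  by case: (o i false); case: (o i true).
(* Going back along the edge to [i] must undo the step made by [tau]. *)
have oS i : o (step true i) true = o i true.
  apply: negb_inj; rewrite -oN; apply: (@step_inj_dir (tau (step true i))).
  by rewrite -tau_step step_down_up tau_step stepK.
exists (o 0 true) => i s.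
have -> : o i s = if s then o i true else ~~ o i true by case: s; rewrite ?oN.
have -> : o i true = o 0 true by elim/vertex_ind: i => // i <-.
by case: s; case: (o 0 true).
Qed.

Lemma orientation_translation : (forall i, o i true) -> forall i, tau i = i + tau 0.
Proof.
move=> oT; elim/vertex_ind=> [|i IH]; first by rewrite add0r.
by rewrite tau_step oT IH /step addrAC.
Qed.

Lemma orientation_reflection : (forall i, ~~ o i true) -> forall i, tau i = tau 0 - i.
Proof.
move=> oF; elim/vertex_ind=> [|i IH]; first by rewrite subr0.
by rewrite tau_step (negPf (oF i)) IH /step opprD addrA.
Qed.

End Dihedral.

Lemma arrow_letter_inj s i t j : arrow_letter s i = arrow_letter t j -> s = t /\ i = j.
Proof. by case: s; case: t => // /(congr1 snd); [move=> /= -> | move/addIr ->]. Qed.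

Variant letter_spec : letter n -> Type :=
| IdemLetter i : letter_spec (idem_letter i)
| ArrowLetter s i : letter_spec (arrow_letter s i).

Lemma letterP l : letter_spec l.
Proof.
case: l => [[[|[|[|//]]] ltc] i].
- by rewrite (_ : (_, _) = idem_letter i); [left | congr (_, _); apply: val_inj].
- by rewrite (_ : (_, _) = arrow_letter true i); [right | congr (_, _); apply: val_inj].
(* The letter d_i is the arrow of direction [false] out of i + 1. *)
rewrite (_ : (_, _) = arrow_letter false (i + 1)); first by right.
by rewrite /= addrK; congr (_, _); apply: val_inj.
Qed.

(* Whether the word w, with its idempotents deleted, is the path that starts
   at i and has directions p. *)
Fixpoint reads (p : seq bool) (w : seq (letter n)) (i : vertex) : bool :=
  if w is l :: w' then
    if l.1 == ord0 then (l.2 == i) && reads p w' i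
    else if p is s :: q then (l == arrow_letter s i) && reads q w' (step s i)
    else false
  else p == [::].

Lemma reads_idem p m w i : reads p (idem_letter m :: w) i = (m == i) && reads p w i.
Proof. by []. Qed.

Lemma reads_arrow p s m w i : reads p (arrow_letter s m :: w) i =
  if p is t :: q then [&& s == t, m == i & reads q w (step t i)] else false.
Proof.
case: p => [|t q]; first by case: s.
have -> : [&& s == t, m == i & reads q w (step t i)] =
    (arrow_letter s m == arrow_letter t i) && reads q w (step t i).
  rewrite andbA; congr (_ && _); apply/andP/eqP => [[/eqP-> /eqP->] //|].
  by move/arrow_letter_inj => [-> ->].
by case: s.
Qed.

Lemma reads_path q p i j : reads q (path_letters p i) j = (q == p) && (nilp p || (i == j)).
Proof.
elim: p q i j => [|s p IH] q i j; first by rewrite /= andbT.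
rewrite reads_arrow; case: q => [//|t q]; rewrite IH eqseq_cons eq_sym -andbA.
case: eqP => //= ->; rewrite andbC -andbA; congr (_ && _).
by case: (i =P j) => [->|]; rewrite ?eqxx ?orbT ?andbF.
Qed.

(** The prefix read by [v] has as many steps as [v] has arrows, so at most one summand is nonzero.
    This is the source of the product rule for path coefficients. *)
Lemma reads_cat (K : nzRingType) p v w i : (reads p (v ++ w) i)%:R =
  \sum_(k < (size p).+1) (reads (take k p) v i)%:R *
    (reads (drop k p) w (target (take k p) i))%:R :> K.
Proof.
elim: v p i => [|l v IH] p i.
  rewrite big_ord_recl take0 drop0 /= mul1r big1 ?addr0 // => k _.
  by case: p k => [[]|s q] k //=; rewrite mul0r.
case: (letterP l) => [m|s m]; rewrite cat_cons.
  under eq_bigr do rewrite reads_idem -mulnb natrM -mulrA.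
  by rewrite reads_idem -mulnb natrM IH mulr_sumr.
rewrite reads_arrow; case: p => [|t q].
  by rewrite big_ord_recl big_ord0 reads_arrow mul0r addr0.
rewrite big_ord_recl [size _]/= take0 reads_arrow mul0r add0r.
under eq_bigr do rewrite [take _ _]/= [drop _ _]/= reads_arrow andbA -mulnb natrM -mulrA.
by rewrite andbA -mulnb natrM IH mulr_sumr.
Qed.

End CyclicQuiver.

(** * Coefficients of paths in the path algebra, computed on words of the free algebra *)

HB.lock Definition path_coef (K : fieldType) (N : nat) (p : seq bool) (i : 'I_N.+3)
    (x : FreeAlg K N.+3) : K :=
  \sum_(w <- msupp x) x@_w * (reads p (w : seq _) i)%:R.

Section PathCoefficients.
Variables (K : fieldType) (N : nat).
Local Notation n := N.+3.
Local Notation A := (FreeAlg K n).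
Local Notation vertex := 'I_n.

Local Notation C := (@path_coef K N).

Lemma path_coefEw p i (d : {fset _}) x : (msupp x `<=` d)%fset ->
  C p i x = \sum_(w <- d) x@_w * (reads p (w : seq _) i)%:R.
Proof.
rewrite path_coef.unlock => le; rewrite [LHS](big_fset_incl _ le) => //= w wd /mcoeff_outdom ->.
by rewrite mul0r.
Qed.

Lemma path_coef_linear p i c x y : C p i (c *: x + y) = c * C p i x + C p i y.
Proof.
pose d := (msupp (c *: x + y) `|` (msupp x `|` msupp y))%fset.
rewrite !(@path_coefEw _ _ d) ?fsubsetUl //; last 2 first.
- by rewrite fsubsetU // fsubsetUr orbT.
- by rewrite fsubsetU // fsubsetUl orbT.
rewrite mulr_sumr -big_split; apply: eq_bigr => w _ /=.
by rewrite mcoeffD mcoeffZ mulrDl mulrA.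
Qed.

Lemma path_coef0 p i : C p i 0 = 0.
Proof. by rewrite path_coef.unlock msupp0 big_seq_fset0. Qed.

Lemma path_coefD p i x y : C p i (x + y) = C p i x + C p i y.
Proof. by rewrite -[x]scale1r path_coef_linear scale1r mul1r. Qed.

Lemma path_coefZ p i c x : C p i (c *: x) = c * C p i x.
Proof. by rewrite -[c *: x]addr0 path_coef_linear path_coef0 addr0. Qed.

Lemma path_coefB p i x y : C p i (x - y) = C p i x - C p i y.
Proof. by rewrite -scaleN1r path_coefD path_coefZ mulN1r. Qed.

Lemma path_coef_sum p i (I : Type) (r : seq I) G :
  C p i (\sum_(j <- r) G j) = \sum_(j <- r) C p i (G j).
Proof. by apply: (big_morph _ (path_coefD p i) (path_coef0 p i)). Qed.

Lemma path_coef_mon p i w : C p i (mon K w) = (reads p w i)%:R.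
Proof. by rewrite path_coef.unlock mon.unlock msuppU1 big_seq_fset1 mcoeffUU mul1r. Qed.

Lemma path_coef1 p i : C p i 1 = (p == [::])%:R.
Proof. by rewrite -mon0 path_coef_mon. Qed.

Lemma path_coefM p i x y : C p i (x * y) =
  \sum_(k < (size p).+1) C (take k p) i x * C (drop k p) (target (take k p) i) y.
Proof.
elim/FreeAlg_mon_ind: x => [|c x x' Hx Hx'|v].
- by rewrite mul0r path_coef0 big1 // => k _; rewrite path_coef0 mul0r.
- rewrite mulrDl -scalerAl path_coef_linear Hx Hx' mulr_sumr -big_split.
  by apply: eq_bigr => k _; rewrite path_coef_linear mulrDl mulrA.
elim/FreeAlg_mon_ind: y => [|c y y' Hy Hy'|w].
- by rewrite mulr0 path_coef0 big1 // => k _; rewrite path_coef0 mulr0.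
- rewrite mulrDr -FreeAlg_scaleAr path_coef_linear Hy Hy' mulr_sumr -big_split.
  by apply: eq_bigr => k _; rewrite path_coef_linear mulrDr mulrCA.
rewrite monM path_coef_mon reads_cat.
by apply: eq_bigr => k _; rewrite !path_coef_mon.
Qed.

(** This makes [C [::] i] the character chi_i of the vertex [i]. *)
Lemma path_coefM0 i x y : C [::] i (x * y) = C [::] i x * C [::] i y.
Proof. by rewrite path_coefM big_ord_recl big_ord0 addr0. Qed.

(** The coefficient of an arrow is a derivation from the character of its source to that of its
    target. *)
Lemma path_coefM1 s i x y :
  C [:: s] i (x * y) = C [::] i x * C [:: s] i y + C [:: s] i x * C [::] (step s i) y.
Proof. by rewrite path_coefM !big_ord_recl big_ord0 addr0. Qed.

Lemma path_coefM2 a b i x y :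
  C [:: a; b] i (x * y) =
  C [::] i x * C [:: a; b] i y + C [:: a] i x * C [:: b] (step a i) y
    + C [:: a; b] i x * C [::] (step b (step a i)) y.
Proof. by rewrite path_coefM !big_ord_recl big_ord0 addr0 addrA. Qed.

Lemma path_coefM3 a b c i x y :
  C [:: a; b; c] i (x * y) =
  C [::] i x * C [:: a; b; c] i y + C [:: a] i x * C [:: b; c] (step a i) y
    + C [:: a; b] i x * C [:: c] (step b (step a i)) y
    + C [:: a; b; c] i x * C [::] (step c (step b (step a i))) y.
Proof. by rewrite path_coefM !big_ord_recl big_ord0 addr0 !addrA. Qed.

(** Since [r] has no shorter paths, it must use up all of [p], and the outer factors contribute only
    their constant terms. *)
Lemma path_coef_relator p i a r b :
  (forall q j, (size q < size p)%N -> C q j r = 0) ->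
  C p i (a * r * b) = C [::] i a * C p i r * C [::] (target p i) b.
Proof.
move=> r0.
have ar q : (size q <= size p)%N -> C q i (a * r) = C [::] i a * C q i r.
  move=> le_q; rewrite path_coefM big_ord_recl take0 drop0 /=.
  rewrite big1 ?addr0 // => k _; rewrite r0 ?mulr0 //=.
  by rewrite size_drop /bump /=; have := ltn_ord k; lia.
rewrite path_coefM big_ord_recr /= take_size drop_size ar //.
rewrite big1 ?add0r // => k _; rewrite ar; last by rewrite size_take; case: ifP; lia.
by rewrite r0 ?mulr0 ?mul0r // size_take ltn_ord.
Qed.

End PathCoefficients.

(** * The defining relations in terms of directions and sources *)

Section Relators.
Variables (K : fieldType) (N : nat).
Local Notation n := N.+3.
Local Notation A := (FreeAlg K n).
Local Notation vertex := 'I_n.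
Local Notation C := (@path_coef K N).

Definition idem_elt (i : vertex) : A := mon K [:: idem_letter i].
Definition path_elt (p : seq bool) (i : vertex) : A := mon K (path_letters p i).

Definition cubic_source (s : bool) (i : vertex) : vertex := if s then i else i + 1.

(** Both cubic families in one formula: [s] is the middle direction of the left-hand path, [true]
    giving the relation from i to i + 1 and [false] the one from i + 1 to i. *)
Definition cubic (al be : vertex -> K) (s : bool) (i : vertex) : A :=
  let j := cubic_source s i in
  path_elt [:: false; s; true] j -
    (al i *: path_elt [:: s; ~~ s; s] j + be i *: path_elt [:: true; s; false] j).

Variant relator (al be : vertex -> K) : A -> Prop :=
| RelIdem i j : relator al be (idem_elt i * idem_elt j - (if i == j then idem_elt i else 0))
| RelSum : relator al be (\sum_i idem_elt i - 1)
| RelSource s i : relator al be (idem_elt i * path_elt [:: s] i - path_elt [:: s] i)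
| RelTarget s i : relator al be (path_elt [:: s] i * idem_elt (step s i) - path_elt [:: s] i)
| RelCubic s i : relator al be (cubic al be s i).

Lemma insub_modn m : insub (m %% n)%N = Some (inZp m : vertex).
Proof. by rewrite insubT ?ltn_mod // => lt_mn; congr Some; apply: val_inj. Qed.

Lemma cycE (f : vertex -> K) m : cyc f m = f m%:R.
Proof. by rewrite /cyc insub_modn inZp_nat. Qed.

Lemma genE c m : gen K n c m = mon K [:: (c, m%:R)].
Proof. by rewrite /gen insub_modn inZp_nat fmuE mon.unlock. Qed.

Lemma eeE m : ee K n m = idem_elt m%:R.
Proof. by rewrite /ee genE /idem_elt /idem_letter; congr (mon _ [:: (_, _)]); apply: val_inj. Qed.

Lemma uuE m : uu K n m = path_elt [:: true] m%:R.
Proof. by rewrite /uu genE. Qed.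

Lemma ddE m : dd K n m = path_elt [:: false] (m%:R + 1).
Proof. by rewrite /dd genE /path_elt /= addrK. Qed.

Lemma predE (i : vertex) : (i + n).-1%:R = i - 1 :> vertex.
Proof.
by rewrite addnS /= natrD vertex_natK -[N.+2%:R](addrK 1) -mulrSr natr_order add0r.
Qed.

Lemma path3E a b c i : path_elt [:: a; b; c] i =
  path_elt [:: a] i * path_elt [:: b] (step a i) * path_elt [:: c] (step b (step a i)).
Proof. by rewrite /path_elt !monM. Qed.

Lemma relHE (al be : vertex -> K) r : relH al be r <-> relator al be r.
Proof.
have cubicT i : cubic al be true i =
    dd K n (i + n).-1 * uu K n (i + n).-1 * uu K n i
    - (cyc al i *: (uu K n i * dd K n i * uu K n i)
     + cyc be i *: (uu K n i * uu K n i.+1 * dd K n i.+1)).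
  rewrite /cubic !path3E !ddE !uuE !cycE predE mulrSr !vertex_natK.
  by rewrite /step /= ?subrK ?addrK.
have cubicF i : cubic al be false i =
    dd K n i * dd K n (i + n).-1 * uu K n (i + n).-1
    - (cyc al i *: (dd K n i * uu K n i * dd K n i)
     + cyc be i *: (uu K n i.+1 * dd K n i.+1 * dd K n i)).
  rewrite /cubic !path3E !ddE !uuE !cycE predE mulrSr !vertex_natK.
  by rewrite /step /= ?subrK ?addrK ?subrK.
split.
- case=> [[[i [j ->]]|[->|[[i ->]|[[i ->]|[[i ->]|[i ->]]]]]]|[[i ->]|[i ->]]].
  + by rewrite !eeE !vertex_natK; exact: RelIdem.
  + by under eq_bigr do rewrite eeE vertex_natK; exact: RelSum.
  + by rewrite eeE uuE !vertex_natK; exact: RelSource.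
  + by rewrite eeE uuE mulrSr !vertex_natK; exact: (RelTarget _ _ true).
  + by rewrite eeE ddE mulrSr !vertex_natK; exact: RelSource.
  + have := RelTarget al be false (i + 1).
    by rewrite eeE ddE !vertex_natK /step addrK.
  + by rewrite -cubicT; exact: RelCubic.
  by rewrite -cubicF; exact: RelCubic.
case=> [i j||s i|s i|[] i].
- by left; left; exists i, j; rewrite !eeE !vertex_natK.
- by left; right; left; under [in RHS]eq_bigr do rewrite eeE vertex_natK.
- left; case: s.
  + by right; right; left; exists i; rewrite eeE uuE !vertex_natK.
  right; right; right; right; left; exists (i - 1).
  by rewrite eeE ddE mulrSr !vertex_natK subrK.
- left; case: s.
  + by right; right; right; left; exists i; rewrite eeE uuE mulrSr !vertex_natK.
  right; right; right; right; right; exists (i - 1).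
  by rewrite eeE ddE !vertex_natK subrK.
- by right; left; exists i.
by right; right; exists i.
Qed.

(** * Linear forms that descend to the quotient *)

Section Vanishing.
Variables al be : vertex -> K.

Lemma path_coef_path q p i j :
  C q j (path_elt p i) = ((q == p) && (nilp p || (i == j)))%:R.
Proof. by rewrite path_coef_mon reads_path. Qed.

(** The other relators are zero already in the path algebra, hence have no path coefficients at
    all. *)
Lemma path_coef_rel r : relator al be r ->
  (forall q j, C q j r = 0) \/ exists s i, r = cubic al be s i.
Proof.
case=> [i i'||s i|s i|s i]; [left=> q j | left=> q j | left=> q j | left=> q j | right].
- rewrite path_coefB monM path_coef_mon !reads_idem; case: (i =P i') => [<-|ne].
    by rewrite path_coef_mon reads_idem andbA andbb subrr.
  by rewrite path_coef0 subr0; case: (i =P j) => //= <-; case: eqP => // /esym.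
- rewrite path_coefB path_coef_sum path_coef1 (bigD1 j) //= path_coef_mon reads_idem eqxx.
  rewrite big1 ?addr0 ?subrr // => i /negPf ij.
  by rewrite path_coef_mon reads_idem ij.
- rewrite path_coefB monM !path_coef_mon cat_cons reads_idem reads_arrow.
  by case: q => [|t q]; case: (i == j); rewrite /= ?andbF subrr.
- rewrite path_coefB monM !path_coef_mon !reads_arrow; case: q => [|t q]; first by rewrite subrr.
  case: (s =P t) => //= [<-|]; last by rewrite subrr.
  by case: (i =P j) => //= [<-|]; rewrite ?eqxx subrr.
by exists s, i.
Qed.

Lemma path_coef_cubic q j s i : C q j (cubic al be s i) =
  (cubic_source s i == j)%:R * ((q == [:: false; s; true])%:R -
    (al i * (q == [:: s; ~~ s; s])%:R + be i * (q == [:: true; s; false])%:R)).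
Proof.
rewrite /cubic path_coefB path_coefD 2!path_coefZ 3!path_coef_path /=.
by case: (_ == j); rewrite ?andbT ?andbF ?mul1r ?mul0r ?mulr0n ?mulr0 ?addr0 ?subr0.
Qed.

Lemma path_coef_rel_lt3 r q j : relator al be r -> (size q < 3)%N -> C q j r = 0.
Proof.
move=> /path_coef_rel[-> //|[s [i ->]]]; rewrite path_coef_cubic.
case: q => [|? [|? [|? ?]]] //= _;
by rewrite ?eqseq_cons ?andbF ?mulr0 ?addr0 ?subr0 ?mulr0.
Qed.

(** Relators start in length 3, so coefficients of shorter paths are well defined on the
    quotient. *)
Lemma path_coef_ideal_lt3 x q j :
  in_ideal (relator al be) x -> (size q < 3)%N -> C q j x = 0.
Proof.
move=> [s [sR ->]] lt3; rewrite path_coef_sum big_seq big1 // => t /sR tR.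
rewrite path_coef_relator => [|p k lt_pq]; last first.
  exact: path_coef_rel_lt3 tR (ltn_trans lt_pq lt3).
by rewrite (path_coef_rel_lt3 _ tR lt3) mulr0 mul0r.
Qed.

(* For x = y * al i + t * be i these are the linear forms on paths of length 3
   from i to i + 1 that vanish on relators; varying y and t recovers al i and be i. *)
Definition cubic_form (x y t : K) (i : vertex) (z : A) : K :=
  x * C [:: false; true; true] i z + y * C [:: true; false; true] i z
    + t * C [:: true; true; false] i z.

Lemma cubic_form_ideal x y t i z : x = y * al i + t * be i ->
  in_ideal (relator al be) z -> cubic_form x y t i z = 0.
Proof.
move=> -> [s [sR ->]]; rewrite /cubic_form !path_coef_sum !mulr_sumr -!big_split.
rewrite big_seq big1 // => -[[a r] b] /sR /= Rr.
rewrite !path_coef_relator; try by move=> q j lt3; apply: path_coef_rel_lt3.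
(* All three paths end at i + 1, so the outer factors contribute one common scalar and the claim
   reduces to a single relator. *)
rewrite /= !(addrK, subrK).
suff r_eq0 : (y * al i + t * be i) * C [:: false; true; true] i r
    + y * C [:: true; false; true] i r + t * C [:: true; true; false] i r = 0.
  by rewrite -[RHS](mulr0 (C [::] i a * C [::] (step true i) b)) -r_eq0; ring.
have [r0|[u [j ->]]] := path_coef_rel Rr; first by rewrite !r0 !mulr0 !addr0.
(* The relators with middle direction [false] involve none of the three paths. *)
rewrite !path_coef_cubic; case: u => /=; last by ring.
by case: (j =P i) => [->|_]; rewrite ?mul1r ?mul0r; ring.
Qed.

End Vanishing.
End Relators.

(** Conditions (1) and, below, (2), with indices in the ring Z/n instead of natural numbers. *)
Definition translated (K : fieldType) (N : nat) (al be al' be' la : 'I_N.+3 -> K) (k : 'I_N.+3) :=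
  forall i, al' i = la (i + k) / la (i + k - 1) * al (i + k) /\
            be' i = la (i + k + 1) / la (i + k - 1) * be (i + k).

Definition reflected (K : fieldType) (N : nat) (al be al' be' la : 'I_N.+3 -> K) (k : 'I_N.+3) :=
  forall i, al' i = - ((la (- i - k))^-1 * la (- i - k - 1) * (be (- i - k - 1))^-1
                        * al (- i - k - 1)) /\
            be' i = (la (- i - k))^-1 * la (- i - k - 1 - 1) * (be (- i - k - 1))^-1.

(** A representative map [f] is linear and multiplicative only modulo the target ideal; for [q] of
    length below 3 the coefficient kills that ideal, so the composite is truly linear. *)
HB.lock Definition pullback_coef (K : fieldType) (N : nat) (f : FreeAlg K N.+3 -> FreeAlg K N.+3)
    (q : seq bool) (i : 'I_N.+3) (x : FreeAlg K N.+3) : K := path_coef q i (f x).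

(** * From an isomorphism to the parameters: pulling back characters and derivations *)

Section Isomorphism.
Variables (K : fieldType) (N : nat).
Local Notation n := N.+3.
Local Notation A := (FreeAlg K n).
Local Notation vertex := 'I_n.
Local Notation C := (@path_coef K N).
Variables (al be al' be' : vertex -> K).
Local Notation I := (in_ideal (relator al be)).
Local Notation I' := (in_ideal (relator al' be')).

Variable f : A -> A.
Hypothesis f_congr : forall x y, I (x - y) -> I' (f x - f y).
Hypothesis f_add : forall x y, I' (f (x + y) - (f x + f y)).
Hypothesis f_scale : forall c x, I' (f (c *: x) - c *: f x).
Hypothesis f_mul : forall x y, I' (f (x * y) - f x * f y).
Hypothesis f_one : I' (f 1 - 1).
Hypothesis f_surj : forall y, exists x, I' (f x - y).

Definition lin_form (L : A -> K) := forall c x y, L (c *: x + y) = c * L x + L y.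

Lemma lin_form_diff L x y : lin_form L -> L (x - y) = L x - L y.
Proof. by move=> lin; rewrite addrC -scaleN1r lin mulN1r addrC. Qed.

Lemma lin_formD L x y : lin_form L -> L (x + y) = L x + L y.
Proof. by move=> lin; rewrite -[x in LHS]scale1r lin mul1r. Qed.

Section Pullback.
Variable L : A -> K.
Hypotheses (L_lin : lin_form L) (L_ideal : forall z, I' z -> L z = 0).

Lemma form_congr x y : I' (x - y) -> L x = L y.
Proof. by move/L_ideal; rewrite lin_form_diff // => /subr0_eq. Qed.

Lemma pullback_lin : lin_form (L \o f).
Proof.
move=> c x y; rewrite /= (form_congr (f_add _ _)) -[f (c *: x)]scale1r L_lin.
by rewrite mul1r (form_congr (f_scale _ _)) -[c *: f x]addr0 L_lin -(subrr 0)
   lin_form_diff // subrr addr0.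
Qed.

Lemma pullbackM x y : L (f (x * y)) = L (f x * f y).
Proof. exact: form_congr. Qed.

Lemma pullback_congr x y : I (x - y) -> L (f x) = L (f y).
Proof. by move/f_congr/form_congr. Qed.

End Pullback.

Lemma path_coef_lin q i : lin_form (C q i).
Proof. by move=> c x y; rewrite path_coef_linear. Qed.

Lemma lin_form0 L : lin_form L -> L 0 = 0.
Proof. by move=> lin; rewrite -(subrr 0) lin_form_diff // subrr. Qed.

Lemma path_coef_I' q i z : (size q < 3)%N -> I' z -> C q i z = 0.
Proof. by move=> lt3 /path_coef_ideal_lt3 ->. Qed.

Local Notation P := (pullback_coef f).
Local Notation chi := (pullback_coef f [::]).
Local Notation D s := (pullback_coef f [:: s]).

Lemma pullback_coef_lin q i : (size q < 3)%N -> lin_form (P q i).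
Proof.
move=> lt3 c x y; rewrite pullback_coef.unlock.
by apply: (pullback_lin (L := C q i)) => [|z]; [exact: path_coef_lin | exact: path_coef_I'].
Qed.

Lemma pullback_coef0 q i : (size q < 3)%N -> P q i 0 = 0.
Proof. by move=> lt3; apply: lin_form0; apply: pullback_coef_lin. Qed.

Lemma pullback_coef1 q i : (size q < 3)%N -> P q i 1 = (q == [::])%:R.
Proof.
move=> lt3; rewrite pullback_coef.unlock -(path_coef1 K q i).
by apply: form_congr f_one => [|z]; [exact: path_coef_lin | exact: path_coef_I'].
Qed.

Lemma pullback_coef_rel q i x y : (size q < 3)%N ->
  relator al be (x - y) -> P q i x = P q i y.
Proof.
move=> lt3 /in_ideal_rel xy; rewrite pullback_coef.unlock.
apply: (pullback_congr (L := C q i)) xy => [|z]; first exact: path_coef_lin.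
exact: path_coef_I'.
Qed.

Lemma chiM i x y : chi i (x * y) = chi i x * chi i y.
Proof.
rewrite pullback_coef.unlock -path_coefM0; apply: (pullbackM (L := C [::] i)) => [|z].
  exact: path_coef_lin.
exact: path_coef_I'.
Qed.

Lemma DM s i x y : D s i (x * y) = chi i x * D s i y + D s i x * chi (step s i) y.
Proof.
rewrite pullback_coef.unlock -path_coefM1; apply: (pullbackM (L := C [:: s] i)) => [|z].
  exact: path_coef_lin.
exact: path_coef_I'.
Qed.

Lemma pullback_coef_surj y : exists x, forall q i, (size q < 3)%N -> P q i x = C q i y.
Proof.
have [x fx] := f_surj y; exists x => q i lt3; rewrite pullback_coef.unlock.
by apply: form_congr fx => [|z]; [exact: path_coef_lin | exact: path_coef_I'].
Qed.

Let chi_rel i x y (Rxy : relator al be (x - y)) := @pullback_coef_rel [::] i x y isT Rxy.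
Let D_rel s i x y (Rxy : relator al be (x - y)) := @pullback_coef_rel [:: s] i x y isT Rxy.

(** The values of [chi i] on the e_m are orthogonal idempotents of a field with sum 1, so exactly
    one of them is 1. *)
Lemma chi_idem i : exists j, forall m, chi i (idem_elt K m) = (m == j)%:R.
Proof.
have chi_sum : \sum_m chi i (idem_elt K m) = 1.
  transitivity (chi i 1); last by rewrite pullback_coef1.
  rewrite -(chi_rel i (RelSum al be)).
  rewrite (big_morph (chi i) (id1 := 0) (op1 := +%R)) // => [x y|].
    by apply: lin_formD; apply: pullback_coef_lin.
  exact: pullback_coef0.
have [j chi_j|] := pickP (fun m => chi i (idem_elt K m) != 0); last first.
  move=> chi0; move/eqP: chi_sum; rewrite big1 ?(eq_sym 0) ?oner_eq0 // => m _.
  exact/eqP/negbFE/chi0.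
have idemM m m' : chi i (idem_elt K m) * chi i (idem_elt K m') =
    if m == m' then chi i (idem_elt K m) else 0.
  rewrite -chiM (chi_rel i (RelIdem al be m m')).
  by case: eqP => // _; apply: pullback_coef0.
exists j => m; have := idemM m j; case: eqP => [-> _|_ /eqP].
  by apply: (mulfI chi_j); rewrite mulr1 idemM eqxx.
by rewrite mulf_eq0 (negPf chi_j) orbF => /eqP.
Qed.

Section VertexMap.
Variable tau : vertex -> vertex.
Hypothesis chi_tau : forall i m, chi i (idem_elt K m) = (m == tau i)%:R.

(** An arrow absorbs the idempotents at both its ends; these are distinct, so [chi i] kills one of
    them. *)
Lemma chi_arrow i s m : chi i (path_elt K [:: s] m) = 0.
Proof.
have := chi_rel i (RelTarget al be s m); have := chi_rel i (RelSource al be s m).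
rewrite [X in X = _ -> _]chiM [X in _ -> X = _ -> _]chiM !chi_tau.
case: (m =P tau i) => [<-|_]; last by rewrite mul0r.
by rewrite (negPf (step_neq s m)) mulr0.
Qed.

Lemma chiE i x : chi i x = C [::] (tau i) x.
Proof.
elim/FreeAlg_letter_ind: x => [|c x y Hx Hy||l x Hx].
- by rewrite path_coef0 pullback_coef0.
- by rewrite pullback_coef_lin // path_coef_linear Hx Hy.
- by rewrite pullback_coef1 // path_coef1.
rewrite chiM path_coefM0 Hx; congr (_ * _); case: (letterP l) => [m|s m].
  by rewrite -/(idem_elt K m) chi_tau path_coef_mon reads_idem andbT.
by rewrite -/(path_elt K [:: s] m) chi_arrow path_coef_path.
Qed.

(** Surjectivity provides a preimage of e_i, and on it the characters at [i] and at any other vertex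
    take different values. *)
Lemma tau_inj : injective tau.
Proof.
move=> i j tau_ij; have [x xC] := pullback_coef_surj (idem_elt K i).
have fxC k : chi k x = (i == k)%:R by rewrite xC // path_coef_mon reads_idem andbT.
apply/eqP; have := fxC j; rewrite chiE -tau_ij -chiE fxC eqxx; case: eqP => // _ /eqP.
by rewrite oner_eq0.
Qed.

(** Multiplying the arrow by the idempotents at its ends shows that [D s i] sees only arrows from
    [tau i] to [tau (step s i)]. *)
Lemma D_arrow s i t m :
  D s i (path_elt K [:: t] m) =
    ((m == tau i) && (step t m == tau (step s i)))%:R * D s i (path_elt K [:: t] m).
Proof.
rewrite -{1}(D_rel s i (RelSource al be t m)) DM chi_arrow mulr0 addr0.
rewrite -{1}(D_rel s i (RelTarget al be t m)) DM chi_arrow mul0r add0r.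
by rewrite !chi_tau -mulnb natrM mulrAC mulrA.
Qed.

(* Otherwise the derivation [D s i] would be inner, hence would vanish on the
   preimage of the arrow on which it is supposed to be 1. *)
Lemma D_nonzero s i : exists t,
  step t (tau i) = tau (step s i) /\ D s i (path_elt K [:: t] (tau i)) != 0.
Proof.
have [t Dt|D0] := pickP (fun t => D s i (path_elt K [:: t] (tau i)) != 0).
  exists t; split=> //; apply/eqP; apply: contraNT Dt => /negPf ne.
  by rewrite D_arrow ne andbF mul0r.
have Darr t m : D s i (path_elt K [:: t] m) = 0.
  by rewrite D_arrow; case: eqP => [->|_]; rewrite ?mul0r //= (eqP (negbFE (D0 t))) mulr0.
(* With all arrows killed, only the idempotents matter. The relation e_j e_j' = 0 makes the values
   of [D s i] at e_j and e_j' opposite, so it is [k] times the difference of the two characters. *)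
set j := tau i; set j' := tau (step s i); pose k := D s i (idem_elt K j').
have jj' : j != j' by rewrite (inj_eq tau_inj) eq_sym step_neq.
have idemM m m' := D_rel s i (RelIdem al be m m').
have Dj : D s i (idem_elt K j) = - k.
  apply/eqP; rewrite -addr_eq0 /k; have := idemM j j'; rewrite (negPf jj') DM !chi_tau.
  by rewrite !eqxx mul1r mulr1 addrC pullback_coef0 // => ->.
have inner x : D s i x = k * (C [::] j' x - C [::] j x).
  elim/FreeAlg_letter_ind: x => [|c x y Hx Hy||l x Hx].
  - by rewrite !path_coef0 pullback_coef0 // subrr mulr0.
  - by rewrite pullback_coef_lin // !path_coef_linear Hx Hy; ring.
  - by rewrite pullback_coef1 // !path_coef1 subrr mulr0.
  rewrite DM Hx !chiE -/j -/j' !path_coefM0.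
  suff -> : D s i (mon K [:: l]) = k * (C [::] j' (mon K [:: l]) - C [::] j (mon K [:: l])) by ring.
  case: (letterP l) => [m|t m]; last first.
    by rewrite -/(path_elt K [:: t] m) Darr !path_coef_path subrr mulr0.
  rewrite -/(idem_elt K m) !path_coef_mon !reads_idem !andbT.
  case: (m =P j') => [->|/eqP mj'].
    by rewrite eq_sym (negPf jj') subr0 mulr1.
  case: (m =P j) => [->|/eqP mj]; first by rewrite Dj sub0r mulrN1.
  rewrite subrr mulr0; have := idemM m m; rewrite eqxx DM !chi_tau.
  by rewrite (negPf mj) (negPf mj') mul0r mulr0 addr0 => <-.
have [x xC] := pullback_coef_surj (path_elt K [:: s] i).
have := inner x; rewrite -!chiE !xC // !path_coef_path /= !eqxx subrr mulr0.
by move/eqP; rewrite oner_eq0.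
Qed.


(** * Leading-order scalars of the arrows and comparison of the cubic relations *)

Section Orientation.
Variable e : bool.
Hypothesis tau_step : forall i s, tau (step s i) = step (s == e) (tau i).
Hypothesis D_arrow_tau : forall s i, D s i (path_elt K [:: s == e] (tau i)) != 0.

(** The coefficient of an arrow of H' in the image of the arrow of H that corresponds to it under
    [tau]. *)
Let w i s := D s i (path_elt K [:: s == e] (tau i)).

Lemma D_arrowE s i t : D s i (path_elt K [:: t] (tau i)) = (t == (s == e))%:R * w i s.
Proof.
rewrite D_arrow eqxx tau_step (inj_eq (@step_inj_dir N (tau i))) /=.
by case: eqP => [->|_]; rewrite ?mul0r.
Qed.

Lemma D_path3E a b c i s1 s2 s3 :
  D a i (path_elt K [:: s1] (tau i)) *
  D b (step a i) (path_elt K [:: s2] (step s1 (tau i))) *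
  D c (step b (step a i)) (path_elt K [:: s3] (step s2 (step s1 (tau i)))) =
  ([:: s1; s2; s3] == [:: a == e; b == e; c == e])%:R *
    (w i a * w (step a i) b * w (step b (step a i)) c).
Proof.
rewrite !eqseq_cons andbT D_arrowE; case: (s1 =P _) => [->|_]; last by rewrite !mul0r.
rewrite -tau_step D_arrowE; case: (s2 =P _) => [->|_]; last by rewrite mul0r mulr0 !mul0r.
by rewrite -tau_step D_arrowE; case: (s3 =P _) => _; rewrite ?mul1r // !mul0r mulr0.
Qed.

(** The images have no constant terms, so the three steps of the path are shared out one to each
    factor. *)
Lemma path_coef3_image a b c i x y z :
  (forall j, chi j x = 0) -> (forall j, chi j y = 0) -> (forall j, chi j z = 0) ->
  C [:: a; b; c] i (f (x * y) * f z) =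
  D a i x * D b (step a i) y * D c (step b (step a i)) z.
Proof.
move=> x0 y0 z0; have PE q j u : C q j (f u) = P q j u by rewrite pullback_coef.unlock.
rewrite path_coefM3 !PE chiM DM !(x0, y0, z0) !(mul0r, mulr0, add0r, addr0).
congr (_ * _); rewrite -PE.
rewrite (form_congr (L := C [:: a; b] i) _ _ (f_mul x y)) => [|u0|u]; last 2 first.
- exact: path_coef_lin.
- exact: path_coef_I'.
by rewrite path_coefM2 !PE !(x0, y0) !(mul0r, mulr0, add0r, addr0).
Qed.

Lemma cubic_form_image x y t i s1 s2 s3 :
  x = y * al' i + t * be' i ->
  cubic_form x y t i (f (path_elt K [:: s1; s2; s3] (tau i))) =
    let on p := ([:: s1; s2; s3] == map (eq_op^~ e) p)%:R in
    w i true * (x * on [:: false; true; true] * (w (step false i) true * w i false)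
      + y * on [:: true; false; true] * (w i true * w (step true i) false)
      + t * on [:: true; true; false]
          * (w (step true i) true * w (step true (step true i)) false)).
Proof.
move=> xE; rewrite path3E.
(* A single coefficient of length 3 need not kill [I'], but [cubic_form] does by [xE]; this permits
   splitting the image of the product. *)
rewrite (form_congr (L := cubic_form x y t i) _ _ (f_mul _ _)) => [|c u v|u]; last 2 first.
- by rewrite /cubic_form !path_coef_linear; ring.
- exact: cubic_form_ideal.
rewrite /cubic_form !path_coef3_image => *; try exact: chi_arrow.
rewrite !D_path3E step_up_down step_down_up /=; ring.
Qed.

(** The product of the scalars of the pair u_i, d_i of H'. After [w i true] is cancelled, the cubic
    relation depends on these products only. *)
Let p i := w i true * w (step true i) false.

Lemma cubic_form_relation x y t i s m :
  x = y * al' i + t * be' i -> cubic_source s m = tau i ->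
  let on r z := (r == map (eq_op^~ e) z)%:R in
  let val r := x * on r [:: false; true; true] * p (step false i)
      + y * on r [:: true; false; true] * p i
      + t * on r [:: true; true; false] * p (step true i) in
  val [:: false; s; true] = al m * val [:: s; ~~ s; s] + be m * val [:: true; s; false].
Proof.
move=> xE src on val; set L := cubic_form x y t i.
have L_lin : lin_form L by move=> c u v; rewrite /L /cubic_form !path_coef_linear; ring.
have L_I' u : I' u -> L u = 0 by apply: cubic_form_ideal.
have Lf_lin : lin_form (L \o f) by apply: pullback_lin.
have L_path s1 s2 s3 : L (f (path_elt K [:: s1; s2; s3] (tau i))) = w i true * val [:: s1; s2; s3].
  by rewrite /L cubic_form_image // /val /on /p step_up_down.
apply: (mulfI (D_arrow_tau true i)); rewrite -/(w i true) -L_path mulrDr.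
rewrite !(mulrCA (w i true)) -!L_path.
have := pullback_congr L_lin L_I' (in_ideal_rel (RelCubic al be s m)).
rewrite src => ->; rewrite -[LHS]/((L \o f) _) Lf_lin; congr (_ + _).
by rewrite -[X in (L \o f) X]addr0 Lf_lin (lin_form0 Lf_lin) addr0.
Qed.

Lemma orientation_parameters : exists p : vertex -> K, (forall i, p i != 0) /\
  forall i, if e then
    al' i * p (step false i) = al (tau i) * p i /\
    be' i * p (step false i) = be (tau i) * p (step true i)
  else let m := step false (tau i) in
    be m * (al' i * p (step false i)) = - (al m * p i) /\
    be m * (be' i * p (step false i)) = p (step true i).
Proof.
exists p; split=> [i|i]; first by rewrite mulf_neq0 // D_arrow_tau.
(* The choices (1, 0) and (0, 1) of [y] and [t] isolate [al' i] and [be' i]. *)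
have al_eq : al' i = 1 * al' i + 0 * be' i by rewrite mul1r mul0r addr0.
have be_eq : be' i = 0 * al' i + 1 * be' i by rewrite mul1r mul0r add0r.
have rel s m x y t xE src := @cubic_form_relation x y t i s m xE src.
case: e in rel * => [|m].
  have src : cubic_source true (tau i) = tau i by [].
  have := rel _ _ _ _ _ al_eq src; have := rel _ _ _ _ _ be_eq src.
  move=> /= beE alE; split; [move: alE | move: beE];
  by rewrite ?(mul1r, mul0r, mulr1, mulr0, addr0, add0r).
(* Under a reflection u_i corresponds to the d-arrow out of [tau i], so the relator with middle d is
   used. The two outer monomials trade places, whence the inverse of [be] and the sign in (2). *)
have src : cubic_source false m = tau i by exact: subrK.
have := rel _ _ _ _ _ al_eq src; have := rel _ _ _ _ _ be_eq src.
move=> /= beE alE; split; [move/eqP: alE | move: beE];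
  rewrite ?(mul1r, mul0r, mulr1, mulr0, addr0, add0r) //.
by rewrite eq_sym addrC addr_eq0 => /eqP.
Qed.

End Orientation.
End VertexMap.

Lemma iso_parameters : (forall i, be i != 0) -> exists (la : vertex -> K) (k : vertex),
  (forall i, la i != 0) /\
  (translated al be al' be' la k \/ reflected al be al' be' la k).
Proof.
move=> be_neq0; have [tau chi_tau] := fin_all_exists chi_idem.
have [o oP] := fin_all_exists (fun z : vertex * bool => D_nonzero chi_tau z.2 z.1).
have tau_o i s : tau (step s i) = step (o (i, s)) (tau i) by have [] := oP (i, s).
have [e oE] := orientation_constant (tau_inj chi_tau) tau_o.
have tau_step i s : tau (step s i) = step (s == e) (tau i) by rewrite tau_o oE.
have D_tau s i : D s i (path_elt K [:: s == e] (tau i)) != 0.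
  by have [_] := oP (i, s); rewrite oE.
have [p [p_neq0]] := orientation_parameters chi_tau tau_step D_tau.
case: e oE tau_step {D_tau} => oE tau_step p_rel.
- have tauE : forall i, tau i = i + tau 0 by apply: orientation_translation tau_step _ => i.
  (* Chosen so that lambda at [tau i] is [p i]. *)
  exists (fun m => p (m - tau 0)), (tau 0); split=> //; left=> i.
  have -> : i + tau 0 - tau 0 = i by ring.
  have -> : i + tau 0 - 1 - tau 0 = step false i by rewrite /step; ring.
  have -> : i + tau 0 + 1 - tau 0 = step true i by rewrite /step; ring.
  rewrite -tauE; have [alE beE] := p_rel i.
  by split; apply: (mulIf (p_neq0 (step false i))); rewrite ?alE ?beE mulrAC divfK // mulrC.
have tauE : forall i, tau i = tau 0 - i by apply: orientation_reflection tau_step _ => i.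
(* The pair u_i, d_i of H' comes from the pair of index [tau i - 1] in H, so lambda at [tau i - 1]
   has to be [p i]. *)
exists (fun m => p (- m + tau 0 - 1)), (- tau 0); split=> //; right=> i.
have -> : - (- i - - tau 0) + tau 0 - 1 = step false i by rewrite /step; ring.
have -> : - (- i - - tau 0 - 1) + tau 0 - 1 = i by ring.
have -> : - (- i - - tau 0 - 1 - 1) + tau 0 - 1 = step true i by rewrite /step; ring.
have -> : - i - - tau 0 - 1 = step false (tau i) by rewrite (tauE i) /step; ring.
have [alE beE] := p_rel i; have bm_neq0 := be_neq0 (step false (tau i)).
split; apply: (mulIf (p_neq0 (step false i))); apply: (mulfI bm_neq0); rewrite ?alE ?beE.
  by field; rewrite p_neq0 bm_neq0.
by field; rewrite p_neq0 bm_neq0.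
Qed.

End Isomorphism.

(** * From the parameters to an isomorphism: relabelling vertices and rescaling the d_i *)

Lemma scale_relation (K : fieldType) (V : lmodType K) (c a b : K) (x y z : V) :
  c *: x - ((c * a) *: y + (c * b) *: z) = c *: (x - (a *: y + b *: z)).
Proof. by rewrite scalerBr scalerDr !scalerA. Qed.

(** The version for reflections, where the outer monomials [x] and [z] change places. *)
Lemma scale_relation_rev (K : fieldType) (V : lmodType K) (c a b : K) (x y z : V) :
  (c * b) *: z - ((- (c * a)) *: y + c *: x) = (- c) *: (x - (a *: y + b *: z)).
Proof.
rewrite !scaleNr scalerBr scalerDr !scalerA [in RHS]opprB opprD opprK addrA.
by rewrite [_ + (c * a) *: y]addrC.
Qed.

Section MonomialIsomorphism.
Variables (K : fieldType) (N : nat).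
Local Notation n := N.+3.
Local Notation A := (FreeAlg K n).
Local Notation vertex := 'I_n.

Definition letter_map (e : bool) (sg : vertex -> vertex) (l : letter n) : letter n :=
  if l.1 == 0 then idem_letter (sg l.2)
  else if l.1 == 1 then arrow_letter e (sg l.2)
  else arrow_letter (~~ e) (sg (l.2 + 1)).

(** Rescaling the d_i suffices: up to a common factor a cubic relation sees only the product of the
    two scalars of each pair u_i, d_i. *)
Definition letter_scale (mu : vertex -> K) (l : letter n) : K :=
  if (l.1 == 0) || (l.1 == 1) then 1 else mu l.2.

Lemma letter_map_idem e sg i : letter_map e sg (idem_letter i) = idem_letter (sg i).
Proof. by []. Qed.

Lemma letter_map_arrow e sg s i :
  letter_map e sg (arrow_letter s i) = arrow_letter (s == e) (sg i).
Proof. by case: s; rewrite /letter_map /= ?subrK //; case: e. Qed.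

Lemma letter_mapK e sg sg' : cancel sg sg' -> cancel (letter_map e sg) (letter_map e sg').
Proof.
move=> sgK l; case: (letterP l) => [i|s i].
  by rewrite !letter_map_idem sgK.
by rewrite !letter_map_arrow sgK; case: s; case: e.
Qed.

Variables (e : bool) (sg sg' : vertex -> vertex) (mu : vertex -> K).
Hypotheses (sgK : cancel sg sg') (sg'K : cancel sg' sg)
  (sg_step : forall s i, sg (step s i) = step (s == e) (sg i))
  (mu_neq0 : forall i, mu i != 0).

Let F : A -> A := monomial_endo (letter_map e sg) (letter_scale mu).
Let G : A -> A := monomial_endo (letter_map e sg')
  (fun l => (letter_scale mu (letter_map e sg' l))^-1).

Lemma letter_scale_neq0 l : letter_scale mu l != 0.
Proof. by rewrite /letter_scale; case: ifP; rewrite ?oner_eq0. Qed.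

Lemma FK : cancel F G.
Proof.
apply: monomial_endoK => [|l]; first exact: letter_mapK.
by rewrite letter_mapK // divff // letter_scale_neq0.
Qed.

Lemma GK : cancel G F.
Proof.
by apply: monomial_endoK => [|l]; [exact: letter_mapK | rewrite mulVf // letter_scale_neq0].
Qed.

Lemma F_idem i : F (idem_elt K i) = idem_elt K (sg i).
Proof. by rewrite /F /idem_elt monomial_endo_mon big_seq1 scale1r. Qed.

Definition path_scale p i := \prod_(l <- path_letters p i) letter_scale mu l.

Lemma F_path p i : F (path_elt K p i) =
  path_scale p i *: path_elt K (map (eq_op^~ e) p) (sg i).
Proof.
rewrite /F /path_elt monomial_endo_mon; congr (_ *: mon _ _).
elim: p i => //= s p IH i; rewrite letter_map_arrow IH; congr (_ :: path_letters _ _).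
by rewrite sg_step.
Qed.

Lemma path_scale_neq0 p i : path_scale p i != 0.
Proof. by rewrite prodf_seq_neq0; apply/allP=> l _; apply: letter_scale_neq0. Qed.

Lemma path_scale_cons s p i : path_scale (s :: p) i =
  (if s then 1 else mu (i - 1)) * path_scale p (step s i).
Proof. by rewrite /path_scale big_cons; case: s. Qed.

Lemma path_scale_nil i : path_scale [::] i = 1.
Proof. exact: big_nil. Qed.

Variables al be al' be' : vertex -> K.

(** Conditions (1) and (2) with denominators cleared and lambda equal to [mu]. For a reflection the
    pair of index [m] goes to the pair of index [sg m - 1]. *)
Hypothesis cubic_coefs : forall m, let m' := if e then sg m else sg m - 1 in
  if e then al m * mu m = mu (m - 1) * al' m' /\ be m * mu (m + 1) = mu (m - 1) * be' m'
  else al m * mu m = - (be m * mu (m + 1) * al' m') /\ mu (m - 1) = be m * mu (m + 1) * be' m'.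
Hypothesis be_neq0 : forall m, be m != 0.

Lemma F_cubic s m : exists2 c : K, c != 0 &
  F (cubic al be s m) = c *: cubic al' be' (s == e) (if e then sg m else sg m - 1).
Proof.
pose j := cubic_source s m.
have src : cubic_source (s == e) (if e then sg m else sg m - 1) = sg j.
  have sgT : sg (m + 1) = step (true == e) (sg m) := sg_step true m.
  by rewrite /j; case: (s); case: (e) sgT => //= sgT; rewrite ?sgT /= ?subrK.
(* The scalar of the arrow of direction [s] in the pair [m], a factor common to all three
   monomials. *)
pose g := if s then 1 else mu m.
have g_neq0 : g != 0 by rewrite /g; case: ifP; rewrite ?oner_eq0.
have scale1 : path_scale [:: false; s; true] j = mu (m - 1) * g.
  rewrite !path_scale_cons path_scale_nil /g /j /step; case: (s) => /=.
    by rewrite !mulr1.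
  by rewrite addrK !mulr1 mulrC.
have scale2 : path_scale [:: s; ~~ s; s] j = mu m * g.
  rewrite !path_scale_cons path_scale_nil /g /j /step; case: (s) => /=;
  by rewrite ?addrK ?subrK ?addrK ?mul1r ?mulr1.
have scale3 : path_scale [:: true; s; false] j = mu (m + 1) * g.
  rewrite !path_scale_cons path_scale_nil /g /j /step; case: (s) => /=;
  by rewrite ?addrK ?mul1r ?mulr1.
have -> : F (cubic al be s m) =
    (mu (m - 1) * g) *: path_elt K (map (eq_op^~ e) [:: false; s; true]) (sg j)
    - ((al m * (mu m * g)) *: path_elt K (map (eq_op^~ e) [:: s; ~~ s; s]) (sg j)
      + (be m * (mu (m + 1) * g)) *: path_elt K (map (eq_op^~ e) [:: true; s; false]) (sg j)).
  rewrite /F monomial_endoB monomial_endoD 2!monomial_endoZ -/F.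
  by rewrite -scale1 -scale2 -scale3 !F_path !scalerA.
have := cubic_coefs m; rewrite /cubic src /=; case: (e) => -[alE beE].
  exists (mu (m - 1) * g); first by rewrite mulf_neq0.
  have -> : al m * (mu m * g) = mu (m - 1) * g * al' (sg m) by rewrite mulrA alE mulrAC.
  have -> : be m * (mu (m + 1) * g) = mu (m - 1) * g * be' (sg m) by rewrite mulrA beE mulrAC.
  by rewrite !eqb_id; exact: scale_relation.
exists (- (be m * mu (m + 1) * g)); first by rewrite oppr_eq0 !mulf_neq0.
have -> : mu (m - 1) * g = be m * mu (m + 1) * g * be' (sg m - 1) by rewrite beE mulrAC.
have -> : al m * (mu m * g) = - (be m * mu (m + 1) * g * al' (sg m - 1)).
  by rewrite mulrA alE mulNr mulrAC.
rewrite !eqbF_neg negbK mulrA; exact: scale_relation_rev.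
Qed.

Lemma F_rel_idem i j :
  F (idem_elt K i * idem_elt K j - (if i == j then idem_elt K i else 0)) =
  1 *: (idem_elt K (sg i) * idem_elt K (sg j)
        - (if sg i == sg j then idem_elt K (sg i) else 0)).
Proof.
rewrite scale1r /F monomial_endoB monomial_endoM -/F !F_idem (inj_eq (can_inj sgK)).
by case: eqP => _; rewrite ?F_idem // /F monomial_endo0.
Qed.

Lemma F_rel_sum : F (\sum_i idem_elt K i - 1) = 1 *: (\sum_i idem_elt K i - 1).
Proof.
rewrite scale1r /F monomial_endoB monomial_endo1 monomial_endo_sum -/F; congr (_ - _).
rewrite [RHS](reindex sg); last by exists sg' => i _.
by apply: eq_bigr => i _; rewrite F_idem.
Qed.

Lemma F_rel_source s i : F (idem_elt K i * path_elt K [:: s] i - path_elt K [:: s] i) =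
  path_scale [:: s] i *:
    (idem_elt K (sg i) * path_elt K [:: s == e] (sg i) - path_elt K [:: s == e] (sg i)).
Proof.
rewrite /F monomial_endoB monomial_endoM -/F F_idem F_path.
by rewrite scalerBr -FreeAlg_scaleAr.
Qed.

Lemma F_rel_target s i : F (path_elt K [:: s] i * idem_elt K (step s i) - path_elt K [:: s] i) =
  path_scale [:: s] i *:
    (path_elt K [:: s == e] (sg i) * idem_elt K (step (s == e) (sg i))
     - path_elt K [:: s == e] (sg i)).
Proof.
rewrite /F monomial_endoB monomial_endoM -/F F_idem F_path sg_step.
by rewrite scalerBr -scalerAl.
Qed.

Lemma F_relator r : relator al be r ->
  exists c r', relator al' be' r' /\ F r = c *: r'.
Proof.
case=> [i j||s i|s i|s i].
- by eexists _, _; split; last exact: F_rel_idem; exact: RelIdem.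
- by eexists _, _; split; last exact: F_rel_sum; exact: RelSum.
- by eexists _, _; split; last exact: F_rel_source; exact: RelSource.
- by eexists _, _; split; last exact: F_rel_target; exact: RelTarget.
by have [c _ Fc] := F_cubic s i; eexists _, _; split; last exact: Fc; exact: RelCubic.
Qed.

(** Each relator of the target is, up to a nonzero scalar, the image under [F] of a relator, so the
    inverse [G] carries it back. *)
Lemma G_relator r' : relator al' be' r' ->
  exists c r, relator al be r /\ G r' = c *: r.
Proof.
have GF c r s : relator al be r -> c != 0 -> F r = c *: s ->
    exists c' r, relator al be r /\ G s = c' *: r.
  move=> Rr c_neq0 Fr; exists c^-1, r; split=> //.
  have -> : s = F (c^-1 *: r) by rewrite /F monomial_endoZ -/F Fr scalerA mulVf // scale1r.
  exact: FK.
have dirK s : ((s == e) == e) = s by case: s; case: (e).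
case=> [i j||s i|s i|s i].
- have := F_rel_idem (sg' i) (sg' j); rewrite !sg'K.
  by apply: GF (oner_neq0 K); exact: RelIdem.
- by apply: GF (oner_neq0 K) F_rel_sum; exact: RelSum.
- have := F_rel_source (s == e) (sg' i); rewrite sg'K dirK.
  by apply: GF; [exact: RelSource | exact: path_scale_neq0].
- have := F_rel_target (s == e) (sg' i); rewrite sg'K dirK.
  by apply: GF; [exact: RelTarget | exact: path_scale_neq0].
(* For a reflection the index [m] with [sg m - 1 = i] is [sg' (i + 1)]. *)
have [c c_neq0] := F_cubic (s == e) (if e then sg' i else sg' (i + 1)).
have -> : (if e then sg (if e then sg' i else sg' (i + 1))
           else sg (if e then sg' i else sg' (i + 1)) - 1) = i.
  by case: (e); rewrite sg'K ?addrK.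
by rewrite dirK; apply: GF c_neq0; exact: RelCubic.
Qed.

(** [F] is an automorphism of the free algebra matching the two ideals: [F_relator] makes it well
    defined on the quotient, [G_relator] injective, and the other clauses hold as equalities. *)
Lemma monomial_H_iso : H_iso al be al' be'.
Proof.
have relF x : in_ideal (relH al be) x -> in_ideal (relH al' be') (F x).
  apply: monomial_endo_ideal => r /relHE/F_relator[c [r' [Rr' Er]]].
  by exists c, r'; split; [apply/relHE | exact: Er].
have relG x : in_ideal (relH al' be') x -> in_ideal (relH al be) (G x).
  apply: monomial_endo_ideal => r /relHE/G_relator[c [r' [Rr' Er]]].
  by exists c, r'; split; [apply/relHE | exact: Er].
have congr0 (x y : A) : x = y -> congH al' be' x y.
  by move=> ->; rewrite /congH subrr; exact: in_ideal0.
exists F; split; first by move=> x y /relF; rewrite /F monomial_endoB.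
split; first by move=> x y; apply: congr0; exact: monomial_endoD.
split; first by move=> c x; apply: congr0; exact: monomial_endoZ.
split; first by move=> x y; apply: congr0; exact: monomial_endoM.
split; first by apply: congr0; exact: monomial_endo1.
split; last by move=> y; exists (G y); apply: congr0; exact: GK.
move=> x y; rewrite /congH => /relG.
have -> : G (F x - F y) = x - y by rewrite /G monomial_endoB -/G !FK.
by [].
Qed.

End MonomialIsomorphism.

(** * Both directions in terms of conditions (1) and (2) *)

Section ParameterChange.
Variables (K : fieldType) (N : nat) (al be al' be' la : 'I_N.+3 -> K) (k : 'I_N.+3).
Hypotheses (be_neq0 : forall i, be i != 0) (la_neq0 : forall i, la i != 0).

Lemma translated_H_iso : translated al be al' be' la k -> H_iso al be al' be'.
Proof.
(* Condition (1) relates index [i] of H' to index [i + k] of H, so the map on vertices subtracts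
   [k]. *)
move=> tr; apply: (@monomial_H_iso K N true (fun i => i - k) (fun i => i + k) la).
- exact: subrK.
- exact: addrK.
- by case=> i; rewrite /step /=; ring.
- by [].
- move=> m /=; have [-> ->] := tr (m - k); rewrite !subrK.
  by split; field; rewrite la_neq0.
- exact: be_neq0.
Qed.

Lemma reflected_H_iso : reflected al be al' be' la k -> H_iso al be al' be'.
Proof.
move=> tr; apply: (@monomial_H_iso K N false (fun i => - i - k) (fun i => - i - k) la).
- by move=> i /=; ring.
- by move=> i /=; ring.
- by case=> i; rewrite /step /=; ring.
- by [].
(* At this index condition (2) involves [al m] and [be m]. *)
- move=> m /=; have [-> ->] := tr (- m - k - 1).
  have -> : - (- m - k - 1) - k = m + 1 by ring.
  rewrite addrK; split; field; by rewrite ?la_neq0 ?be_neq0.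
- exact: be_neq0.
Qed.

Lemma H_iso_parameters : H_iso al be al' be' ->
  exists (la : 'I_N.+3 -> K) (k : 'I_N.+3), (forall i, la i != 0) /\
  (translated al be al' be' la k \/ reflected al be al' be' la k).
Proof.
move=> [f [fc [fD [fZ [fM [f1 [_ fs]]]]]]].
have toH (a b : 'I_N.+3 -> K) x : in_ideal (relator a b) x -> in_ideal (relH a b) x.
  by apply: in_ideal_mono => r /relHE.
have ofH (a b : 'I_N.+3 -> K) x : in_ideal (relH a b) x -> in_ideal (relator a b) x.
  by apply: in_ideal_mono => r /relHE.
apply: (@iso_parameters K N al be al' be' f) => //.
- by move=> x y /toH/fc/ofH.
- by move=> x y; apply: ofH; exact: fD.
- by move=> c x; apply: ofH; exact: fZ.
- by move=> x y; apply: ofH; exact: fM.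
- by apply: ofH; exact: f1.
by move=> y; have [x fx] := fs y; exists x; apply: ofH.
Qed.

End ParameterChange.

(** * Natural-number indices modulo n, and the classification *)

Section Indices.
Variables (N : nat) (i k : 'I_N.+3).
Local Notation n := N.+3.

Lemma index_add : (i + k)%N%:R = i + k :> 'I_n.
Proof. by rewrite natrD !vertex_natK. Qed.

Lemma index_pred m : (0 < m)%N -> m.-1%:R = m%:R - 1 :> 'I_n.
Proof. by case: m => // m _; rewrite [in RHS]mulrSr addrK. Qed.

Lemma index_opp c : (2 <= c)%N -> (c * n - i - k)%N%:R = - i - k :> 'I_n.
Proof.
(* Both [i] and [k] are below n, so starting from at least 2n the subtractions do not truncate. *)
move=> c_ge2; rewrite !natrB ?natrM ?natr_order ?mulr0 ?vertex_natK ?sub0r //.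
  by have := ltn_ord i; nia.
by have := ltn_ord i; have := ltn_ord k; nia.
Qed.

End Indices.

Theorem theorem5p2 (K : closedFieldType) (hK : [pchar K] =i pred0)
  (n : nat) (hn : (3 <= n)%N) (al al' be be' : 'I_n -> K)
  (hbe : forall i, be i != 0) (hbe' : forall i, be' i != 0) :
  H_iso al be al' be' <->
  exists (la : 'I_n -> K) (k : 'I_n),
    (forall i, la i != 0) /\
    ((forall i : 'I_n,
        al' i = cyc la (i + k)%N / cyc la ((i + k + n).-1)%N * cyc al (i + k)%N /\
        be' i = cyc la ((i + k).+1)%N / cyc la ((i + k + n).-1)%N * cyc be (i + k)%N)
     \/
     (forall i : 'I_n,
        al' i = - ((cyc la (2 * n - i - k)%N)^-1 * cyc la ((3 * n - i - k).-1)%N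
                   * (cyc be ((3 * n - i - k).-1)%N)^-1 * cyc al ((3 * n - i - k).-1)%N) /\
        be' i = (cyc la (2 * n - i - k)%N)^-1 * cyc la ((3 * n - i - k).-2)%N
                   * (cyc be ((3 * n - i - k).-1)%N)^-1)).
Proof.
case: n => [|[|[|N]]] // in hn al al' be be' hbe hbe' *.
have idx1 (i k : 'I_N.+3) : (i + k + N.+3).-1%:R = i + k - 1 :> 'I_N.+3.
  by rewrite index_pred; [rewrite natrD natr_order addr0 index_add | rewrite addnS].
have idx2 (i k : 'I_N.+3) : (i + k).+1%:R = i + k + 1 :> 'I_N.+3.
  by rewrite mulrSr index_add.
(* Starting from 3n leaves at least n + 2, so taking one or two predecessors cannot stop at 0. *)
have idx3 (i k : 'I_N.+3) : (3 * N.+3 - i - k).-1%:R = - i - k - 1 :> 'I_N.+3.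
  by rewrite index_pred ?index_opp //; have := ltn_ord i; have := ltn_ord k; lia.
have idx4 (i k : 'I_N.+3) : (3 * N.+3 - i - k).-2%:R = - i - k - 1 - 1 :> 'I_N.+3.
  by rewrite index_pred ?idx3 //; have := ltn_ord i; have := ltn_ord k; lia.
split=> [/(H_iso_parameters hbe)|] [la [k [la_neq0 rel]]].
  exists la, k; split=> //; case: rel => rel; [left | right] => i; have := rel i;
  by rewrite !cycE ?idx1 ?idx2 ?idx3 ?idx4 ?index_add ?index_opp.
case: rel => rel.
  apply: (@translated_H_iso _ _ _ _ _ _ la k) => // i; have := rel i.
  by rewrite !cycE ?idx1 ?idx2 ?index_add.
apply: (@reflected_H_iso _ _ _ _ _ _ la k) => // i; have := rel i.
by rewrite !cycE ?idx3 ?idx4 ?index_opp.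
Qed.
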